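(* Let $0<u\le 0.5$, let $A$ be a real $n\times p$ supernodal matrix, and apply the strict compressed pivoting factorization with threshold parameter $u$ to $A$ (as described in the context). Let $\mu_q$ be the maximum absolute value of an entry of the reduced (uneliminated) part of the matrix $A^{(q)}$ obtained after $q$ eliminations. Then growth is bounded by a factor $1+u^{-1}$ per eliminated column: if $A^{(q)}$ is followed by an accepted pivot of size $s\in\{1,2\}$, then $$\mu_{q+s}\le \mu_q\left(1+u^{-1}\right)^s ;$$ in particular $\mu_{q+1}\le\mu_q(1+u^{-1})$ for a $1\times1$ pivot. Moreover, every entry of the computed factor $L$ (in all rows $1,\dots,n$) is bounded in absolute value by $u^{-1}$.
   Context: **Supernodal matrix.** Let $n\ge p\ge 1$. A supernodal matrix is a real $n\times p$ matrix $A=\begin{pmatrix} A_{11} \\ A_{21} \end{pmatrix}$ with entries $a(i,k)$, where $A_{11}$ is $p\times p$ symmetric and $A_{21}$ is $(n-p)\times p$. Row indices $i>p$ are the rows of $A_{21}$. **Compressed matrix.** For $1\le j\le p$, $J_j=\{\,i : p<i\le n,\ j=\arg\max_{1\le k\le p}|a(i,k)|\,\}$, with ties resolved in favour of the lowest $k$. The sets $J_j$ are computed once from the initial $A$ and never change. The compressed matrix $C$ is the $p\times p$ matrix with $c(j,k)=\max_{i\in J_j}|a(i,k)|$ if $J_j\ne\emptyset$, and $c(j,k)=0$ otherwise. **Strict compressed pivoting (exact arithmetic).** Set $A^{(0)}=A$, $C^{(0)}=C$. $A^{(q)}$ and $C^{(q)}$ are the matrices after $q$ columns have been eliminated. Pivots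 are chosen only from the $A_{11}$ part, as $1\times1$ or $2\times2$ diagonal blocks, and the process may stop before all $p$ columns are eliminated. Before an elimination the chosen pivot is brought to position $q+1$ (respectively $q+1,q+2$) by a symmetric interchange of indices in $\{q+1,\dots,p\}$, applied to the rows $1,\dots,p$ and the columns of $A^{(q)}$ (and of the part of $L$ already computed, whose rows are interchanged), and to the columns of $C^{(q)}$. The rows of $A$ with index $>p$, the rows of $C$ and the sets $J_j$ are not permuted. Write $a=a^{(q)}$, $c=c^{(q)}$ after this interchange and $r=q+1$. For a matrix $M$, $|M|$ is the matrix of absolute values of its entries; vector inequalities are entrywise; a maximum over an empty set is $0$. *$1\times 1$ pivot.* With $\gamma=\max\left(\max_{r<i\le p}|a(i,r)|,\ \max_{1\le j\le p}c(j,r)\right)$, the pivot is accepted only if $a(r,r)\neq0$ and $|a(r,r)|\ge u\,\gamma$. Then $l(r,r)=1$, $l(i,r)=a(i,r)/a(r,r)$ for $i>r$, and for $i>r$, $r<k\le p$, $1\le j\le p$, $$a^{(q+1)}(i,k)=a(i,k)-\frac{a(i,r)\,a(k,r)}{a(r,r)},\qquad c^{(q+1)}(j,k)=c(j,k)+\frac{c(j,r)\,|a(k,r)|}{|a(r,r)|}.$$ *$2\times2$ pivot.* With $D=\begin{pmatrix} a(r,r) & a(r,r+1) \\ a(r,r+1) & a(r+1,r+1) \end{pmatrix}$ and, for $t\in\{r,r+1\}$, $\gamma_t=\max\left(\max_{r+1<i\le p}|a(i,t)|,\ \max_{1\le j\le p}c(j,t)\right)$, the pivot is accepted only if $D$ is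 nonsingular and $$|D^{-1}|\begin{pmatrix} \gamma_r \\ \gamma_{r+1} \end{pmatrix}\le\begin{pmatrix} u^{-1} \\ u^{-1} \end{pmatrix}.$$ Then the $2\times2$ diagonal block of $L$ is the identity, $\begin{pmatrix} l(i,r) & l(i,r+1) \end{pmatrix}=\begin{pmatrix} a(i,r) & a(i,r+1) \end{pmatrix} D^{-1}$ for $i>r+1$, and for $i>r+1$, $r+1<k\le p$, $1\le j\le p$, $$a^{(q+2)}(i,k)=a(i,k)-\begin{pmatrix} a(k,r) & a(k,r+1) \end{pmatrix} D^{-1}\begin{pmatrix} a(i,r) \\ a(i,r+1) \end{pmatrix},$$ $$c^{(q+2)}(j,k)=c(j,k)+\begin{pmatrix} |a(k,r)| & |a(k,r+1)| \end{pmatrix} |D^{-1}|\begin{pmatrix} c(j,r) \\ c(j,r+1) \end{pmatrix}.$$ All other entries of $L$ in the eliminated columns (those above the diagonal) are $0$. **Reduced part.** $\mu_q=\max\{|a^{(q)}(i,k)| : q<i\le n,\ q<k\le p\}$. *)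

(* Defs.v *)
From HB Require Import structures.
From mathcomp Require Import all_boot all_order all_fingroup all_algebra.
Set Implicit Arguments.
Unset Strict Implicit.
Unset Printing Implicit Defensive.
Import Order.TTheory GRing.Theory Num.Theory.
Local Open Scope ring_scope.

(* A supernodal matrix has n = p + m rows: usubmx A is A_11, dsubmx A is A_21.
   Row and column indices are 0-based, so "i > p" in 1-based indexing reads
   p <= i here, and the pivot after q eliminations sits at index r = q.  The
   row of A with the index of column k is lshift m k. *)

Section StrictCompressedPivoting.

Variables (R : realFieldType) (p m : nat).

Definition supernodal (A : 'M[R]_(p + m, p)) : Prop :=
  (0 < p)%N /\ (usubmx A)^T = usubmx A.

(* The second conjunct breaks ties in favour of the lowest column. *)
Definition is_argmax (A : 'M[R]_(p + m, p)) (i : 'I_(p + m)) (j : 'I_p) : bool :=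
  [forall k : 'I_p, `|A i k| <= `|A i j|] &&
  [forall k : 'I_p, (k < j)%N ==> (`|A i k| < `|A i j|)].

Definition Jset (A : 'M[R]_(p + m, p)) (j : 'I_p) : {set 'I_(p + m)} :=
  [set i : 'I_(p + m) | (p <= i)%N && is_argmax A i j].

(* All maxima below are of nonnegative quantities, so the default value 0 only
   matters when the index set is empty. *)
Definition compressed (A : 'M[R]_(p + m, p)) : 'M[R]_p :=
  \matrix_(j, k) \big[Num.max/0]_(i in Jset A j) `|A i k|.

(* Columns of stL that are not eliminated yet are 0; entries of stA and stC
   outside the reduced part are stale and never read again. *)
Record state := State {
  stA : 'M[R]_(p + m, p);
  stC : 'M[R]_p;
  stL : 'M[R]_(p + m, p)
}.

Definition init_state (A : 'M[R]_(p + m, p)) : state :=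
  State A (compressed A) 0.

Definition perm_top_rows (s : 'S_p) (M : 'M[R]_(p + m, p)) : 'M[R]_(p + m, p) :=
  col_mx (row_perm s (usubmx M)) (dsubmx M).

Definition interchange (s : 'S_p) (S : state) : state :=
  State (col_perm s (perm_top_rows s (stA S)))
        (col_perm s (stC S))
        (perm_top_rows s (stL S)).

(* The quantities gamma: the pivot block ends at index e (e = r for a 1x1
   pivot, e = r + 1 for a 2x2 pivot) and t is a column of that block. *)
Definition gamma (S : state) (e t : 'I_p) : R :=
  Num.max (\big[Num.max/0]_(i < p | (e < i)%N) `|stA S (lshift m i) t|)
          (\big[Num.max/0]_(j < p) stC S j t).

Definition accept1 (u : R) (S : state) (r : 'I_p) : Prop :=
  let d := stA S (lshift m r) r in
  d != 0 /\ u * gamma S r r <= `|d|.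

Definition elim1 (S : state) (r : 'I_p) : state :=
  let a := stA S in
  let c := stC S in
  let d := a (lshift m r) r in
  State
    (\matrix_(i, k)
       if (r < i)%N && (r < k)%N then a i k - a i r * a (lshift m k) r / d
       else a i k)
    (\matrix_(j, k)
       if (r < k)%N then c j k + c j r * `|a (lshift m k) r| / `|d|
       else c j k)
    (\matrix_(i, k)
       if k == r then
         if i == lshift m r then 1
         else if (r < i)%N then a i r / d else 0
       else stL S i k).

Definition absmx k l (M : 'M[R]_(k, l)) : 'M[R]_(k, l) := map_mx Num.norm M.

Definition pivcol (r r' : 'I_p) (t : 'I_2) : 'I_p := if t == 0 then r else r'.

Definition pivblock (S : state) (r r' : 'I_p) : 'M[R]_2 :=
  let a := stA S in
  \matrix_(s, t)
     if s != t then a (lshift m r) r'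
     else a (lshift m (pivcol r r' s)) (pivcol r r' s).

Definition pivrow k (M : 'M[R]_(k, p)) (r r' : 'I_p) (i : 'I_k) : 'rV[R]_2 :=
  \row_t M i (pivcol r r' t).

Definition accept2 (u : R) (S : state) (r r' : 'I_p) : Prop :=
  let D := pivblock S r r' in
  D \in unitmx /\
  forall t : 'I_2,
    (absmx (invmx D) *m \col_(t' < 2) gamma S r' (pivcol r r' t')) t 0 <= u^-1.

Definition elim2 (S : state) (r r' : 'I_p) : state :=
  let a := stA S in
  let c := stC S in
  let Di := invmx (pivblock S r r') in
  let arow := pivrow a r r' in
  let crow := pivrow c r r' in
  State
    (\matrix_(i, k)
       if (r' < i)%N && (r' < k)%N
       then a i k - (arow (lshift m k) *m Di *m (arow i)^T) 0 0
       else a i k)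
    (\matrix_(j, k)
       if (r' < k)%N
       then c j k
            + (absmx (arow (lshift m k)) *m absmx Di *m (crow j)^T) 0 0
       else c j k)
    (\matrix_(i, k)
       if (k == r) || (k == r') then
         if i == lshift m k then 1
         else if (r' < i)%N
         then (arow i *m Di) 0 (if k == r then 0 else 1)
         else 0
       else stL S i k).

(* pivot_step u q S s S': from the state S after q eliminations, an accepted
   pivot of size s, brought into place by the permutation pi, leads to S'. *)
Variant pivot_step (u : R) (q : nat) (S : state) : nat -> state -> Prop :=
| Pivot1 (pi : 'S_p) (r : 'I_p) of
    nat_of_ord r = q &
    perm_on [set k : 'I_p | (q <= k)%N] pi &
    accept1 u (interchange pi S) r :
    pivot_step u q S 1 (elim1 (interchange pi S) r)
| Pivot2 (pi : 'S_p) (r r' : 'I_p) of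
    nat_of_ord r = q & nat_of_ord r' = q.+1 &
    perm_on [set k : 'I_p | (q <= k)%N] pi &
    accept2 u (interchange pi S) r r' :
    pivot_step u q S 2 (elim2 (interchange pi S) r r').

(* S is a possible state after q eliminations.  Since q need not reach p, the
   process may stop at any point. *)
Inductive factorization (u : R) (A : 'M[R]_(p + m, p)) : nat -> state -> Prop :=
| Fact_init : factorization u A 0 (init_state A)
| Fact_step q s S S' of
    factorization u A q S & pivot_step u q S s S' :
    factorization u A (q + s)%N S'.

Definition mu (q : nat) (M : 'M[R]_(p + m, p)) : R :=
  \big[Num.max/0]_(i < p + m | (q <= i)%N)
    \big[Num.max/0]_(k < p | (q <= k)%N) `|M i k|.

End StrictCompressedPivoting.

(* Main.v *)
(* Each row i of A_21 lies in some J_j, and c(j,k) >= |a(i,k)| is preserved by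
   every elimination, because the update of c is the triangle inequality applied
   to the update of a.  The acceptance tests on C therefore bound all rows of L
   by 1/u, including those of A_21.  A 1x1 pivot adds at most mu/u to an entry
   and a 2x2 pivot at most 2 mu/u, and 1 + 2/u <= (1 + 1/u)^2. *)
Require Import Defs.
From HB Require Import structures.
From mathcomp Require Import all_boot all_order all_fingroup all_algebra.
From mathcomp Require Import lra.
Set Implicit Arguments.
Unset Strict Implicit.
Unset Printing Implicit Defensive.
Import Order.TTheory GRing.Theory Num.Theory.
Local Open Scope ring_scope.

(** * The reduced part and symmetric interchanges *)

Lemma le_mu (R : realFieldType) (p m q : nat) (M : 'M[R]_(p + m, p))
    (i : 'I_(p + m)) (k : 'I_p) :
  (q <= i)%N -> (q <= k)%N -> `|M i k| <= mu q M.
Proof.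
move=> qi qk; rewrite /mu.
apply: le_trans (le_bigmax_cond _ _ qi).
exact: (le_bigmax_cond _ (fun k => `|M i k|) qk).
Qed.

Lemma mu_ge0 (R : realFieldType) (p m q : nat) (M : 'M[R]_(p + m, p)) :
  0 <= mu q M.
Proof. exact: bigmax_ge_id. Qed.

Lemma mu_le (R : realFieldType) (p m q : nat) (M : 'M[R]_(p + m, p)) (x : R) :
  0 <= x ->
  (forall (i : 'I_(p + m)) (k : 'I_p), (q <= i)%N -> (q <= k)%N -> `|M i k| <= x) ->
  mu q M <= x.
Proof.
move=> x0 Mx; apply: bigmax_le => // i qi.
by apply: bigmax_le => // k qk; apply: Mx.
Qed.

(** One source row [i'] serves every column, so the statement applies to [stA] and [stL] alike. A
    permutation supported on indices at least [q] takes reduced rows from reduced rows, and a row of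
    A_21 is its own source. *)
Lemma perm_top_rows_entry (R : realFieldType) (p m : nat) (s : 'S_p)
    (M : 'M[R]_(p + m, p)) (i : 'I_(p + m)) :
  exists2 i' : 'I_(p + m), forall k, perm_top_rows s M i k = M i' k &
    forall q, perm_on [set k : 'I_p | (q <= k)%N] s -> (q <= i)%N -> (q <= i')%N.
Proof.
rewrite -[i]splitK; case: (split i) => j /=.
  exists (lshift m (s j)) => [k|q sq qj]; first by rewrite col_mxEu !mxE.
  by have := perm_closed j sq; rewrite !inE qj.
by exists (rshift p j) => [k|//]; rewrite col_mxEd !mxE.
Qed.

Lemma mu_interchange (R : realFieldType) (p m q : nat) (s : 'S_p)
    (S : state R p m) :
  perm_on [set k : 'I_p | (q <= k)%N] s ->
  mu q (stA (Defs.interchange s S)) <= mu q (stA S).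
Proof.
move=> sq; apply: mu_le (mu_ge0 _ _) _ => i k qi qk; rewrite mxE.
have [i' -> /(_ q sq qi) qi'] := perm_top_rows_entry s (stA S) i.
by apply: le_mu => //; have := perm_closed k sq; rewrite !inE qk.
Qed.

(** * Domination of the rows of A_21 by the compressed matrix *)

Lemma Jset_cover (R : realFieldType) (p m : nat) (A : 'M[R]_(p + m, p))
    (i : 'I_(p + m)) :
  (0 < p)%N -> (p <= i)%N -> exists j, i \in Jset A j.
Proof.
move=> p0 pi; pose k0 := Ordinal p0.
case: (@arg_maxP _ _ _ k0 xpredT (fun k => `|A i k|) isT) => j1 _ j1max.
pose P (j : 'I_p) := [forall k : 'I_p, `|A i k| <= `|A i j|].
have Pj1 : P j1 by apply/forallP => k; apply: j1max.
(* Among all maximizers of the row, the one of lowest index satisfies the tie-breaking rule. *)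
case: (@arg_minnP _ j1 P val Pj1) => j Pj jmin.
exists j; rewrite inE pi /is_argmax; apply/andP; split=> //.
apply/andP; split=> //; apply/forallP => k; apply/implyP => kj.
rewrite ltNge; apply/negP => jk.
have /jmin /= : P k.
  by apply/forallP => l; apply: le_trans jk; move/forallP: Pj.
by rewrite leqNgt kj.
Qed.

(** The sets J_j come from the initial matrix [A], the entries from the current state. All columns
    are included, even stale ones, so the invariant does not mention the number of eliminations. *)
Definition dominated (R : realFieldType) (p m : nat) (A : 'M[R]_(p + m, p))
    (S : state R p m) : Prop :=
  forall i j k, i \in Jset A j -> `|stA S i k| <= stC S j k.

Lemma dominated_init (R : realFieldType) (p m : nat) (A : 'M[R]_(p + m, p)) :
  dominated A (init_state A).
Proof.
move=> i j k iJ; rewrite mxE.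
exact: (le_bigmax_cond _ (fun i => `|A i k|) iJ).
Qed.

Lemma dominated_interchange (R : realFieldType) (p m : nat)
    (A : 'M[R]_(p + m, p)) (s : 'S_p) (S : state R p m) :
  dominated A S -> dominated A (Defs.interchange s S).
Proof.
move=> domS i j k iJ; have := iJ; rewrite inE => /andP[pi _].
(* The interchange fixes the rows of A_21, and it permutes the columns of [stA] and [stC] in the
   same way. *)
have permE k' : perm_top_rows s (stA S) i k' = stA S i k'.
  rewrite /perm_top_rows -[i]splitK; case: (splitP i) => [i' i'E|i' _] /=.
    by move: pi; rewrite i'E leqNgt ltn_ord.
  by rewrite col_mxEd mxE.
rewrite [X in `|X|]mxE [leRHS]mxE permE.
exact: domS.
Qed.

Lemma dominated_elim1 (R : realFieldType) (p m : nat)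
    (A : 'M[R]_(p + m, p)) (S : state R p m) (r : 'I_p) :
  dominated A S -> dominated A (elim1 S r).
Proof.
move=> domS i j k iJ; rewrite !mxE; have := iJ; rewrite inE => /andP[pi _].
(* A row of A_21 always passes the row test, so [stA] and [stC] are updated in exactly the same
   columns. *)
rewrite (leq_trans (ltn_ord r) pi) /=; case: ifP => _; last exact: domS.
apply: le_trans (ler_normB _ _) _; apply: lerD; first exact: domS.
by rewrite !normrM normfV !ler_wpM2r ?invr_ge0 // domS.
Qed.

Lemma dominated_elim2 (R : realFieldType) (p m : nat)
    (A : 'M[R]_(p + m, p)) (S : state R p m) (r r' : 'I_p) :
  dominated A S -> dominated A (elim2 S r r').
Proof.
move=> domS i j k iJ; rewrite !mxE; have := iJ; rewrite inE => /andP[pi _].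
rewrite (leq_trans (ltn_ord r') pi) /=; case: ifP => _; last exact: domS.
apply: le_trans (ler_normB _ _) _; apply: lerD; first exact: domS.
(* The triangle inequality is applied to the outer product, then to the inner one with the inverse
   of the pivot block. *)
apply: le_trans (ler_norm_sum _ _ _) _; apply: ler_sum => t _.
rewrite normrM !mxE; apply: ler_pM => //; last exact: domS.
apply: le_trans (ler_norm_sum _ _ _) _; apply: ler_sum => t' _.
by rewrite normrM !mxE.
Qed.

(** * Multipliers bounded by the acceptance tests *)

(** Rows of A_11 enter the first maximum of [gamma] directly; rows of A_21 enter the second through
    the set J_j that contains them. *)
Lemma le_gamma (R : realFieldType) (p m : nat)
    (A : 'M[R]_(p + m, p)) (S : state R p m) (e t : 'I_p) (i : 'I_(p + m)) :
  dominated A S -> (e < i)%N -> `|stA S i t| <= gamma S e t.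
Proof.
move=> domS ei; rewrite /gamma le_max; case: (ltnP i p) => [ip|pi].
  have -> : i = lshift m (Ordinal ip) by apply: val_inj.
  apply/orP; left.
  exact: (le_bigmax_cond _ (fun i => `|stA S (lshift m i) t|) (_ : (e < Ordinal ip)%N)).
(* The index [e] witnesses that [p] is positive. *)
have [j iJ] := Jset_cover A (leq_ltn_trans (leq0n e) (ltn_ord e)) pi.
apply/orP; right; apply: le_trans (domS _ _ _ iJ) _.
exact: (le_bigmax_cond _ (fun j => stC S j t) isT).
Qed.

Lemma mult1_le (R : realFieldType) (p m : nat) (u : R)
    (A : 'M[R]_(p + m, p)) (S : state R p m) (r : 'I_p) (i : 'I_(p + m)) :
  0 < u -> dominated A S -> accept1 u S r -> (r < i)%N ->
  `|stA S i r / stA S (lshift m r) r| <= u^-1.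
Proof.
move=> u0 domS [d0 acc] ri.
rewrite normrM normfV ler_pdivrMr ?normr_gt0 // ler_pdivlMl //.
by apply: le_trans acc; rewrite ler_wpM2l ?(ltW u0) // (le_gamma _ domS).
Qed.

Lemma mult2_le (R : realFieldType) (p m : nat) (u : R)
    (A : 'M[R]_(p + m, p)) (S : state R p m) (r r' : 'I_p) (i : 'I_(p + m))
    (t : 'I_2) :
  dominated A S -> accept2 u S r r' -> (r' < i)%N ->
  `|(pivrow (stA S) r r' i *m invmx (pivblock S r r')) 0 t| <= u^-1.
Proof.
move=> domS [_ acc] ri; apply: le_trans (acc t); rewrite !mxE.
apply: le_trans (ler_norm_sum _ _ _) _; apply: ler_sum => t' _.
(* Multipliers put the inverse to the right of a row, while the acceptance test puts it to the left
   of a column. Both off-diagonal entries of [pivblock] are the same entry of [stA], so the inverse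
   is symmetric and the two forms agree. *)
have symDi : (invmx (pivblock S r r'))^T = invmx (pivblock S r r').
  rewrite trmx_inv; congr invmx; apply/matrixP => a b; rewrite !mxE eq_sym.
  by case: eqP => //= ->.
rewrite normrM !mxE -{1}symDi mxE mulrC ler_wpM2l //.
exact: le_gamma domS ri.
Qed.

(** * Growth of the reduced part in one elimination *)

Lemma mu_elim1 (R : realFieldType) (p m q : nat) (u : R)
    (A : 'M[R]_(p + m, p)) (S : state R p m) (r : 'I_p) :
  0 < u -> dominated A S -> accept1 u S r -> nat_of_ord r = q ->
  mu q.+1 (stA (elim1 S r)) <= mu q (stA S) * (1 + u^-1).
Proof.
move=> u0 domS acc rq; have v0 : 0 <= u^-1 by rewrite invr_ge0 ltW.
apply: mu_le => [|i k qi qk]; first by rewrite mulr_ge0 ?mu_ge0 ?addr_ge0.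
rewrite mxE rq qi qk /= mulrDr mulr1.
apply: le_trans (ler_normB _ _) _; apply: lerD; first by rewrite le_mu // ltnW.
(* The correction is regrouped as an entry of the reduced part times the multiplier of row [i]. *)
rewrite mulrAC normrM mulrC; apply: ler_pM => //.
  by apply: le_mu; rewrite ?rq // ltnW.
by apply: mult1_le u0 domS acc _; rewrite ?rq.
Qed.

Lemma mu_elim2 (R : realFieldType) (p m q : nat) (u : R)
    (A : 'M[R]_(p + m, p)) (S : state R p m) (r r' : 'I_p) :
  0 < u -> dominated A S -> accept2 u S r r' ->
  nat_of_ord r = q -> nat_of_ord r' = q.+1 ->
  mu q.+2 (stA (elim2 S r r')) <= mu q (stA S) * (1 + u^-1) ^+ 2.
Proof.
move=> u0 domS acc rq r'q; have v0 : 0 <= u^-1 by rewrite invr_ge0 ltW.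
have M0 := mu_ge0 q (stA S).
apply: mu_le => [|i k qi qk]; first by rewrite mulr_ge0 ?exprn_ge0 ?addr_ge0.
rewrite mxE r'q qi qk /=.
have qi' : (q <= i)%N by rewrite ltnW // ltnW.
have qk' : (q <= k)%N by rewrite ltnW // ltnW.
(* Here the multipliers are those of row [lshift m k]; each of the two pivot columns contributes at
   most [mu] times [u^-1]. *)
have upd : `|(pivrow (stA S) r r' (lshift m k) *m invmx (pivblock S r r')
              *m (pivrow (stA S) r r' i)^T) 0 0| <=
           (mu q (stA S) * u^-1) *+ 2.
  rewrite mxE big_ord_recl big_ord1 mulr2n.
  have term t : `|(pivrow (stA S) r r' (lshift m k)
                    *m invmx (pivblock S r r')) 0 t
                  * (pivrow (stA S) r r' i)^T t 0| <= mu q (stA S) * u^-1.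
    rewrite normrM mulrC; apply: ler_pM => //; last first.
      by apply: mult2_le domS acc _; rewrite r'q.
    rewrite !mxE le_mu // /pivcol.
    by case: ifP; rewrite ?rq ?r'q.
  by apply: le_trans (ler_normD _ _) _; apply: lerD; apply: term.
apply: le_trans (ler_normB _ _) _.
apply: le_trans (lerD (le_mu (stA S) qi' qk') upd) _.
(* This is exactly the gap between M (1 + 2/u) and M (1 + 1/u)^2. *)
have : 0 <= mu q (stA S) * (u^-1 ^+ 2) by rewrite mulr_ge0 ?exprn_ge0.
by move: (mu q _) (u^-1) => M v; nra.
Qed.

(** * Bound on L and induction over the pivot steps *)

Lemma multipliers_interchange (R : realFieldType) (p m : nat) (x : R)
    (s : 'S_p) (S : state R p m) :
  (forall i k, `|stL S i k| <= x) ->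
  forall i k, `|stL (Defs.interchange s S) i k| <= x.
Proof.
by move=> Lx i k /=; have [i' -> _] := perm_top_rows_entry s (stL S) i.
Qed.

Lemma multipliers_elim1 (R : realFieldType) (p m : nat) (u : R)
    (A : 'M[R]_(p + m, p)) (S : state R p m) (r : 'I_p) :
  0 < u -> u <= 1 -> dominated A S -> accept1 u S r ->
  (forall i k, `|stL S i k| <= u^-1) ->
  forall i k, `|stL (elim1 S r) i k| <= u^-1.
Proof.
move=> u0 u1 domS acc LS i k; rewrite mxE; case: eqP => // _.
(* The unit diagonal meets the bound because [u <= 1]. *)
case: eqP => _; first by rewrite normr1 invf_ge1.
by case: ifP => ri; [apply: mult1_le u0 domS acc ri | rewrite normr0 invr_ge0 ltW].
Qed.

Lemma multipliers_elim2 (R : realFieldType) (p m : nat) (u : R)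
    (A : 'M[R]_(p + m, p)) (S : state R p m) (r r' : 'I_p) :
  0 < u -> u <= 1 -> dominated A S -> accept2 u S r r' ->
  (forall i k, `|stL S i k| <= u^-1) ->
  forall i k, `|stL (elim2 S r r') i k| <= u^-1.
Proof.
move=> u0 u1 domS acc LS i k; rewrite mxE; case: ifP => // _.
case: eqP => _; first by rewrite normr1 invf_ge1.
by case: ifP => ri; [apply: mult2_le domS acc ri | rewrite normr0 invr_ge0 ltW].
Qed.

(** Columns of L not yet eliminated are 0, so the bound can be carried for all columns at once.
    Domination is carried along because the multiplier bounds rest on it. *)
Lemma factorization_invariant (R : realFieldType) (p m q : nat) (u : R)
    (A : 'M[R]_(p + m, p)) (S : state R p m) :
  0 < u -> u <= 1 -> factorization u A q S ->
  dominated A S /\ forall i k, `|stL S i k| <= u^-1.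
Proof.
move=> u0 u1; elim=> {q S} [|q s S S' _ [domS LS] step].
  split=> [|i k]; first exact: dominated_init.
  by rewrite mxE normr0 invr_ge0 ltW.
case: step => {s S'} [s r _ _ acc|s r r' _ _ _ acc];
  have domS' := dominated_interchange s domS;
  have LS' := multipliers_interchange s LS.
- split; first exact: dominated_elim1.
  exact: multipliers_elim1 u0 u1 domS' acc LS'.
- split; first exact: dominated_elim2.
  exact: multipliers_elim2 u0 u1 domS' acc LS'.
Qed.

Lemma mu_pivot_step (R : realFieldType) (p m q s : nat) (u : R)
    (A : 'M[R]_(p + m, p)) (S S' : state R p m) :
  0 < u -> dominated A S -> pivot_step u q S s S' ->
  mu (q + s)%N (stA S') <= mu q (stA S) * (1 + u^-1) ^+ s.
Proof.
move=> u0 domS; have v0 : 0 <= 1 + u^-1 by rewrite addr_ge0 ?invr_ge0 // ltW.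
case=> {s S'} [s r rq sq acc|s r r' rq r'q sq acc];
  have domS' := dominated_interchange s domS;
  (* The interchange does not increase [mu], so it suffices to compare with the interchanged
     state. *)
  apply: le_trans (ler_wpM2r (exprn_ge0 _ v0) (mu_interchange S sq)).
- by rewrite addn1 expr1; apply: mu_elim1 u0 domS' acc rq.
- by rewrite addn2; apply: mu_elim2 u0 domS' acc rq r'q.
Qed.

Theorem theorem5p1 (R : realFieldType) (p m : nat) (u : R)
    (A : 'M[R]_(p + m, p)) :
  0 < u -> u <= 2^-1 -> supernodal A ->
  [/\ (forall (q s : nat) (S S' : state R p m),
         factorization u A q S -> pivot_step u q S s S' ->
         mu (q + s)%N (stA S') <= mu q (stA S) * (1 + u^-1) ^+ s),
      (forall (q : nat) (S S' : state R p m),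
         factorization u A q S -> pivot_step u q S 1 S' ->
         mu q.+1 (stA S') <= mu q (stA S) * (1 + u^-1)) &
      (forall (q : nat) (S : state R p m),
         factorization u A q S ->
         forall (i : 'I_(p + m)) (k : 'I_p), (k < q)%N ->
           `|stL S i k| <= u^-1)].
Proof.
move=> u0 u2 _; have u1 : u <= 1 by lra.
split=> [q s S S' fS|q S S' fS step|q S fS i k _].
- by have [domS _] := factorization_invariant u0 u1 fS; apply: mu_pivot_step domS.
- have [domS _] := factorization_invariant u0 u1 fS.
  by have := mu_pivot_step u0 domS step; rewrite addn1 expr1.
- by have [_ LS] := factorization_invariant u0 u1 fS; apply: LS.
Qed.
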